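(* As formal power series in $q$ (equivalently, as analytic functions for $|q|<1$), \[ \sum_{m,n\geq 0}\frac{q^{3\frac{m^2+m}{2}+2nm+n^2+3n+2m+1}}{(q;q)_m(q^4;q^4)_{\lfloor n/2\rfloor}}=\frac{1}{(q,q^5,q^6;q^8)_\infty}-\frac{1}{(q^2,q^3,q^7;q^8)_\infty}. \]
   Context: $(a;q)_k=\prod_{i=0}^{k-1}(1-aq^i)$, $(a;q)_\infty=\prod_{i\ge0}(1-aq^i)$, and $(a_1,\dots,a_r;q)_\infty=\prod_{j}(a_j;q)_\infty$. $\lfloor\cdot\rfloor$ is the floor function. *)

(* Defs.v *)
From HB Require Import structures.
From mathcomp Require Import all_boot all_order all_algebra finmap.
From mathcomp Require Import boolp classical_sets functions cardinality.
From mathcomp Require Import topology.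
From mathcomp Require summability.

Set Implicit Arguments.
Unset Strict Implicit.
Unset Printing Implicit Defensive.

Import GRing.Theory.

Local Open Scope classical_set_scope.
Local Open Scope ring_scope.

(* R[[q]]: f : fps R is the series whose coefficient of q^k is f k. *)
Record fps (R : Type) := Fps { fps_coef :> nat -> R }.

Section Ring.
Variable R : comUnitRingType.
Implicit Types (f g h : fps R) (n k : nat).

Lemma fpsP f g : (forall k, f k = g k) -> f = g.
Proof. by case: f g => [f] [g] /= /funext ->. Qed.

HB.instance Definition _ := gen_eqMixin (fps R).
HB.instance Definition _ := gen_choiceMixin (fps R).

Definition fps0 : fps R := Fps (fun=> 0).
Definition fps_add f g := Fps (fun k => f k + g k).
Definition fps_opp f := Fps (fun k => - f k).
Definition fpsC (c : R) : fps R := Fps (fun k => if k == 0%N then c else 0).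
Definition fps_mul f g := Fps (fun k => \sum_(i < k.+1) f i * g (k - i)%N).

Lemma fps_addA : associative fps_add.
Proof. by move=> f g h; apply: fpsP => k /=; rewrite addrA. Qed.
Lemma fps_addC : commutative fps_add.
Proof. by move=> f g; apply: fpsP => k /=; rewrite addrC. Qed.
Lemma fps_add0 : left_id fps0 fps_add.
Proof. by move=> f; apply: fpsP => k /=; rewrite add0r. Qed.
Lemma fps_addN : left_inverse fps0 fps_opp fps_add.
Proof. by move=> f; apply: fpsP => k /=; rewrite addNr. Qed.

HB.instance Definition _ :=
  GRing.isZmodule.Build (fps R) fps_addA fps_addC fps_add0 fps_addN.

Definition fps_trunc n f : {poly R} := \poly_(i < n) f i.

Lemma coef_fps_trunc n f k : (fps_trunc n f)`_k = if (k < n)%N then f k else 0.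
Proof. exact: coef_poly. Qed.

Lemma fps_mul_trunc n f g k : (k < n)%N ->
  fps_mul f g k = (fps_trunc n f * fps_trunc n g)`_k.
Proof.
move=> ltkn; rewrite coefM /=; apply: eq_bigr => i _; rewrite !coef_fps_trunc.
have -> : (i < n)%N by apply: leq_trans ltkn.
by have -> : (k - i < n)%N by apply: leq_ltn_trans ltkn; rewrite leq_subr.
Qed.

Lemma fps_mulC : commutative fps_mul.
Proof.
by move=> f g; apply: fpsP => k; rewrite !(@fps_mul_trunc k.+1) // mulrC.
Qed.

Lemma fps_mulA : associative fps_mul.
Proof.
move=> f g h; apply: fpsP => k.
transitivity ((fps_trunc k.+1 f * (fps_trunc k.+1 g * fps_trunc k.+1 h))`_k).
  rewrite coefM; apply: eq_bigr => i _; rewrite coef_fps_trunc ltn_ord.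
  by rewrite (@fps_mul_trunc k.+1) // ltnS leq_subr.
rewrite mulrA coefM; apply: eq_bigr => i _.
by rewrite coef_fps_trunc ltnS leq_subr (@fps_mul_trunc k.+1).
Qed.

Lemma fps_mul1 : left_id (fpsC 1) fps_mul.
Proof.
move=> f; apply: fpsP => k /=; rewrite big_ord_recl /= mul1r subn0 big1 ?addr0 //.
by move=> i _; rewrite mul0r.
Qed.

Lemma fps_mulDl : left_distributive fps_mul fps_add.
Proof.
move=> f g h; apply: fpsP => k /=; rewrite -big_split /=.
by apply: eq_bigr => i _; rewrite mulrDl.
Qed.

Lemma fps_1neq0 : fpsC 1 != 0 :> fps R.
Proof. by apply/eqP => /(congr1 (fun f => f 0%N))/eqP; rewrite /= oner_eq0. Qed.

HB.instance Definition _ := GRing.Zmodule_isComNzRing.Build (fps R)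
  fps_mulA fps_mulC fps_mul1 fps_mulDl fps_1neq0.

Lemma fps_coef0 k : (0 : fps R) k = 0. Proof. by []. Qed.
Lemma fps_coef1 k : (1 : fps R) k = (k == 0%N)%:R.
Proof. by case: k. Qed.
Lemma fps_coefD f g k : (f + g) k = f k + g k. Proof. by []. Qed.
Lemma fps_coefN f k : (- f) k = - f k. Proof. by []. Qed.
Definition fpsE := (fps_coef0, fps_coef1, fps_coefD, fps_coefN).

Lemma fps_coefM f g k : (f * g) k = \sum_(i < k.+1) f i * g (k - i)%N.
Proof. by []. Qed.

Lemma fps_coefM0 f g : (f * g) 0%N = f 0%N * g 0%N.
Proof. by rewrite fps_coefM big_ord1. Qed.

Lemma fps_coefCM c f k : (fpsC c * f) k = c * f k.
Proof.
rewrite fps_coefM big_ord_recl /= subn0 big1 ?addr0 // => i _.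
by rewrite mul0r.
Qed.

Lemma fps_coef_sum I (r : seq I) (P : pred I) (F : I -> fps R) k :
  (\sum_(i <- r | P i) F i) k = \sum_(i <- r | P i) F i k.
Proof. by elim/big_rec2: _ => [|i x y _ <-]; rewrite fpsE. Qed.

(* If the coefficients of f below m vanish, and so do those of g below n, then
   those of f * g below m + n do. *)
Lemma fps_coefM_eq0 f g m n :
    (forall k, (k < m)%N -> f k = 0) -> (forall k, (k < n)%N -> g k = 0) ->
  forall k, (k < m + n)%N -> (f * g) k = 0.
Proof.
move=> f0 g0 k ltk; rewrite fps_coefM big1 // => i _.
have [/f0 ->|lemi] := ltnP i m; first by rewrite mul0r.
rewrite g0 ?mulr0 //; have lik : (i <= k)%N by rewrite -ltnS.
by rewrite ltn_subLR // (leq_trans ltk) // leq_add2r.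
Qed.

Lemma fps_coefX_eq0 f n : f 0%N = 0 ->
  forall k, (k < n)%N -> (f ^+ n) k = 0.
Proof.
move=> f0; elim: n => [|n IHn] k //; rewrite exprS => ltkn.
by apply: (@fps_coefM_eq0 f (f ^+ n) 1 n) => // -[].
Qed.

Definition fps_unit : {pred fps R} := fun f => f 0%N \is a GRing.unit.

(* 1 / f = (1 / u) * \sum_j (1 - f / u)^j where u is the constant coefficient
   of f; the terms with j > k do not contribute to the coefficient of q^k. *)
Definition fps_inv f : fps R :=
  if fps_unit f then
    Fps (fun k => (fpsC (f 0%N)^-1 *
      \sum_(j < k.+1) (1 - fpsC (f 0%N)^-1 * f) ^+ j) k)
  else f.

Lemma fps_mulVx : {in fps_unit, left_inverse 1 fps_inv *%R}.
Proof.
move=> f uf; apply: fpsP => k; rewrite /fps_inv (uf : fps_unit f).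
set u := f 0%N; set h := 1 - fpsC u^-1 * f.
have h0 : h 0%N = 0 by rewrite /h !fpsE fps_coefCM mulVr // subrr.
transitivity ((fpsC u^-1 * (\sum_(j < k.+1) h ^+ j) * f) k).
  rewrite !fps_coefM; apply: eq_bigr => i _; congr (_ * _).
  transitivity ((fpsC u^-1 * \sum_(j < i.+1) h ^+ j) i); first by [].
  rewrite !fps_coefCM; congr (_ * _).
  rewrite !fps_coef_sum (big_ord_widen k.+1 (fun j => (h ^+ j) i)) //.
  rewrite [in RHS](bigID (fun j : 'I_k.+1 => (j < i.+1)%N)) /=.
  rewrite [X in _ = _ + X]big1 ?addr0 // => j.
  by rewrite -leqNgt => ltij; apply: fps_coefX_eq0.
rewrite mulrAC; have -> : fpsC u^-1 * f = 1 - h by rewrite /h subKr.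
rewrite -opprB mulNr -subrX1 opprB !fpsE.
by rewrite fps_coefX_eq0 // subr0.
Qed.

Lemma fps_unitPl f g : g * f = 1 -> fps_unit f.
Proof.
move=> /(congr1 (fun h : fps R => h 0%N)); rewrite fps_coefM0 fps_coef1 /= => gf1.
by apply/unitrP; exists (g 0%N); rewrite gf1 mulrC.
Qed.

Lemma fps_inv_out : {in [predC fps_unit], fps_inv =1 id}.
Proof. by move=> f /negbTE uf; rewrite /fps_inv (uf : fps_unit f = false). Qed.

HB.instance Definition _ := GRing.ComNzRing_hasMulInverse.Build (fps R)
  fps_mulVx fps_unitPl fps_inv_out.

Lemma fps_unitE f : (f \is a GRing.unit) = (f 0%N \is a GRing.unit).
Proof. by []. Qed.

(* Coefficientwise convergence, each coefficient being eventually constant. *)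
HB.instance Definition _ := isPointed.Build (fps R) 0.
HB.instance Definition _ := Topological.copy (fps R)
  (initial_topology
     (fun f : fps R => (f : {ptws nat -> discrete_topology R}))).

Lemma fps_cvgP (F : set_system (fps R)) (s : fps R) : Filter F ->
  F --> s <-> forall k, F [set f : fps R | f k = s k].
Proof.
move=> FF; split=> [Fs k|Fs].
  apply: Fs; pose U := [set x : discrete_topology R | x = s k].
  exists [set f : fps R | U (f k)]; split => //=.
  exists [set f : {ptws nat -> discrete_topology R} | U (f k)] => //.
  have pc : continuous
      (fun f : {ptws nat -> discrete_topology R} => f k : discrete_topology R).
    exact: (@proj_continuous nat (fun=> discrete_topology R) k).
  exact: (proj1 (continuousP _) pc U (discrete_open U)).
move=> A [B [[C Cop <-] Cs sBA]].
apply: filterS sBA _.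
pose G : set_system {ptws nat -> discrete_topology R} :=
  (fun f : fps R => (f : {ptws nat -> discrete_topology R})) @ F.
suff : G --> ((s : nat -> R) : {ptws nat -> discrete_topology R}).
  by move=> /(_ C); apply; apply: open_nbhs_nbhs.
apply/cvg_sup => k U [V [[W oW <-] Ws sVU]].
have sU : [set f : fps R | f k = s k] `<=` [set f : fps R | U f].
  by move=> f fk; apply: (sVU (f : nat -> R)); rewrite /= (fk : f k = s k).
exact: (filterS sU (Fs k)).
Qed.

Lemma fps_hausdorff : hausdorff_space (fps R).
Proof.
move=> f g fg; apply: fpsP => k.
have near_eq (h : fps R) : nbhs h [set x | x k = h k].
  by have /fps_cvgP/(_ k) := @cvg_refl _ (nbhs h).
by have [h [/= <- <-]] := fg _ _ (near_eq f) (near_eq g).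
Qed.

Definition fpsX : fps R := Fps (fun k => (k == 1%N)%:R).

(* (a; q)_k, (a; q)_oo and (a_1, ..., a_r; q)_oo *)
Definition qpoch (a q : fps R) (k : nat) : fps R :=
  \prod_(i < k) (1 - a * q ^+ i).
Definition qpoch_inf (a q : fps R) : fps R := lim (qpoch a q k @[k --> \oo]).
Definition qpochs_inf (s : seq (fps R)) (q : fps R) : fps R :=
  \prod_(a <- s) qpoch_inf a q.

Lemma qpochS (a q : fps R) k :
  qpoch a q k.+1 = qpoch a q k * (1 - a * q ^+ k).
Proof. exact: big_ord_recr. Qed.

Lemma qpoch_coef_stable (a q : fps R) k n : q 0%N = 0 -> (k < n)%N ->
  qpoch a q n k = qpoch a q k.+1 k.
Proof.
move=> q0 /subnKC <-; elim: (n - k.+1)%N => [|d IHd]; first by rewrite addn0.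
rewrite addnS qpochS mulrBr mulr1 fps_coefD fps_coefN IHd mulrA.
rewrite (@fps_coefM_eq0 _ (q ^+ (k.+1 + d)) 0 (k.+1 + d)) ?subr0 //.
  exact: fps_coefX_eq0.
by rewrite add0n addSn ltnS leq_addr.
Qed.

(* The infinite product converges as soon as q has no constant term, so that
   the limit in qpoch_inf is not a default value. *)
Lemma qpoch_cvg (a q : fps R) : q 0%N = 0 ->
  qpoch a q k @[k --> \oo] --> qpoch_inf a q.
Proof.
move=> q0; suff /cvgP : qpoch a q k @[k --> \oo] -->
  (Fps (fun k => qpoch a q k.+1 k) : fps R) by [].
apply/fps_cvgP => k.
by exists k.+1 => // n /= ltkn; apply: qpoch_coef_stable.
Qed.

Lemma qpoch_inf_coef (a q : fps R) k n : q 0%N = 0 -> (k < n)%N ->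
  qpoch_inf a q k = qpoch a q n k.
Proof.
move=> q0 ltkn; have /fps_cvgP/(_ k)[N _ /(_ (maxn N n))] := @qpoch_cvg a q q0.
rewrite /= leq_maxl => /(_ isT) <-.
by rewrite !(@qpoch_coef_stable a q k) // (leq_trans ltkn) // leq_maxr.
Qed.

Lemma qpoch_coef0 (a q : fps R) k : a 0%N = 0 -> qpoch a q k 0%N = 1.
Proof.
move=> a0; elim: k => [|k IHk]; first by rewrite /qpoch big_ord0.
by rewrite qpochS fps_coefM0 IHk !fpsE fps_coefM0 a0 mul0r subr0 mul1r.
Qed.

Lemma qpoch_unit (a q : fps R) k : a 0%N = 0 -> qpoch a q k \is a GRing.unit.
Proof. by move=> a0; rewrite fps_unitE qpoch_coef0 // unitr1. Qed.

Lemma qpochs_inf_unit (s : seq (fps R)) (q : fps R) : q 0%N = 0 ->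
  (forall a, a \in s -> a 0%N = 0) -> qpochs_inf s q \is a GRing.unit.
Proof.
move=> q0 s0; rewrite /qpochs_inf big_seq; apply: rpred_prod => a /s0 a0.
by rewrite fps_unitE (@qpoch_inf_coef a q 0 1) // qpoch_coef0 // unitr1.
Qed.

End Ring.

(* The family F sums (unconditionally) to s: the net of its partial sums over
   the finite subsets of I, ordered by inclusion, converges to s. *)
Definition fps_has_sum (R : comUnitRingType) (I : choiceType)
    (F : I -> fps R) (s : fps R) : Prop :=
  summability.partial_sum F @ summability.totally --> s.

Lemma fps_has_sum_unique (R : comUnitRingType) (I : choiceType)
    (F : I -> fps R) (s t : fps R) :
  fps_has_sum F s -> fps_has_sum F t -> s = t.
Proof.
have ? := @summability.totally_filter I.
by move=> /(cvg_lim (@fps_hausdorff R)) <- /(cvg_lim (@fps_hausdorff R)) <-.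
Qed.

(* Main.v *)
Require Import Defs.
From mathcomp Require Import all_boot all_order all_algebra finmap ring zify.
From mathcomp Require summability.

(** Put N = m + n; the exponent of q is then N^2 + 3N + 1 + m(m+1)/2. Comparing
    generating functions in z (both satisfy (1 - z) F(z) = (1 + qz) F(q^2 z))
    gives, for each N,
      sum_(m + n = N) q^(m(m+1)/2) / ((q;q)_m (q^4;q^4)_(floor(n/2)))
        = (-q;q^2)_N / (q^2;q^2)_N,
    so the double sum is q sum_N q^(N^2+3N) (-q;q^2)_N / (q^2;q^2)_N. Term by
    term this is (1 + q) L(q^3) - L(q), where
      L(c) = sum_N q^(N^2+N) (-c;q^2)_N / (q^2;q^2)_N
    is Lebesgue's series in base q^2, equal to (-cq^2;q^4)_oo (-q^2;q^2)_oo. The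
    two resulting products are the reciprocals in the theorem. *)

Set Implicit Arguments.
Unset Strict Implicit.
Unset Printing Implicit Defensive.

Import GRing.Theory.
Local Open Scope ring_scope.

(** * Rescaling and shifting of power series *)

Section GeneratingFunctions.
Variable R : comUnitRingType.
Implicit Types (f g : fps R) (c d : R) (n k : nat).

(** The substitution f(z) -> f(cz). *)
Definition fps_scale c f : fps R := Fps (fun k => c ^+ k * f k).

Lemma fps_scaleM c f g : fps_scale c (f * g) = fps_scale c f * fps_scale c g.
Proof.
apply: fpsP => k /=; rewrite big_distrr /=; apply: eq_bigr => i _.
by rewrite mulrACA -exprD subnKC // -ltnS.
Qed.

Lemma fps_coefXM0 f : (fpsX R * f) 0%N = 0.
Proof. by rewrite fps_coefM0 mul0r. Qed.

Lemma fps_coefXMS f k : (fpsX R * f) k.+1 = f k.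
Proof.
rewrite fps_coefM !big_ord_recl /= mul0r add0r mul1r subSS subn0.
by rewrite big1 ?addr0 // => i _; rewrite mul0r.
Qed.

Lemma fps_coefXnM f k n :
  (fpsX R ^+ n * f) k = if (k < n)%N then 0 else f (k - n)%N.
Proof.
elim: n k => [|n IHn] k; first by rewrite expr0 mul1r subn0.
rewrite exprS -mulrA; case: k => [|k]; first by rewrite fps_coefXM0.
by rewrite fps_coefXMS IHn ltnS subSS.
Qed.

Lemma fps_scale1X c d :
  fps_scale c (1 + fpsC d * fpsX R) = 1 + fpsC (d * c) * fpsX R.
Proof.
apply: fpsP => k.
have E e : (1 + fpsC e * fpsX R) k = (k == 0%N)%:R + e * (k == 1%N)%:R.
  by rewrite fps_coefD fps_coef1 fps_coefCM.
rewrite E (_ : fps_scale c _ k = c ^+ k * (1 + fpsC d * fpsX R) k) // E {E}.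
by case: k => [|[|k]] /=; ring.
Qed.

End GeneratingFunctions.

(** * Congruence modulo powers of the variable, and infinite products *)

Section Congruence.
Variable R : comUnitRingType.
Implicit Types (f g q a : fps R) (n k : nat).

(** Stands in for limits: below each degree n infinite products become finite ones, and [fps_eqmodP]
    recovers equality. *)
Definition fps_eqmod n f g := forall k, (k < n)%N -> f k = g k.

Lemma fps_eqmod_refl n f : fps_eqmod n f f.
Proof. by []. Qed.

Lemma fps_eqmod_sym n f g : fps_eqmod n f g -> fps_eqmod n g f.
Proof. by move=> fg k /fg. Qed.

Lemma fps_eqmod_trans n f g h :
  fps_eqmod n f g -> fps_eqmod n g h -> fps_eqmod n f h.
Proof. by move=> fg gh k ltk; rewrite fg ?gh. Qed.

Lemma fps_eqmodD n f f' g g' :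
  fps_eqmod n f f' -> fps_eqmod n g g' -> fps_eqmod n (f + g) (f' + g').
Proof. by move=> ff gg k ltk; rewrite !fpsE ff ?gg. Qed.

Lemma fps_eqmodN n f f' : fps_eqmod n f f' -> fps_eqmod n (- f) (- f').
Proof. by move=> ff k ltk; rewrite !fpsE ff. Qed.

Lemma fps_eqmodM n f f' g g' :
  fps_eqmod n f f' -> fps_eqmod n g g' -> fps_eqmod n (f * g) (f' * g').
Proof.
move=> ff gg k ltk; rewrite !fps_coefM; apply: eq_bigr => i _.
by rewrite ff ?gg //; apply: leq_ltn_trans ltk; rewrite ?leq_subr // -ltnS.
Qed.

Lemma fps_eqmod_sum n I (r : seq I) (F G : I -> fps R) :
    (forall i, fps_eqmod n (F i) (G i)) ->
  fps_eqmod n (\sum_(i <- r) F i) (\sum_(i <- r) G i).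
Proof.
by move=> FG; elim/big_rec2: _ => // i f g _ fg; apply: fps_eqmodD.
Qed.

Lemma fps_eqmod_prod n I (r : seq I) (F G : I -> fps R) :
    (forall i, fps_eqmod n (F i) (G i)) ->
  fps_eqmod n (\prod_(i <- r) F i) (\prod_(i <- r) G i).
Proof.
by move=> FG; elim/big_rec2: _ => // i f g _ fg; apply: fps_eqmodM.
Qed.

Lemma fps_eqmodM0 n f g : fps_eqmod n g 0 -> fps_eqmod n (f * g) 0.
Proof. by move=> g0; rewrite -(mulr0 f); apply: fps_eqmodM. Qed.

Lemma fps_eqmodX0 n q j : q 0%N = 0 -> (n <= j)%N -> fps_eqmod n (q ^+ j) 0.
Proof. by move=> q0 nj k ltk; exact: fps_coefX_eq0 (leq_trans ltk nj). Qed.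

Lemma fps_eqmodP f g : (forall n, fps_eqmod n f g) -> f = g.
Proof. by move=> fg; apply: fpsP => k; apply: (fg k.+1). Qed.

Lemma fps_coef0X q j : q 0%N = 0 -> (q ^+ j.+1) 0%N = 0.
Proof. by move=> q0; rewrite exprS fps_coefM0 q0 mul0r. Qed.

Lemma qpoch0 a q : qpoch a q 0 = 1.
Proof. by rewrite /qpoch big_ord0. Qed.

Lemma qpoch0l q k : qpoch 0 q k = 1.
Proof. by rewrite /qpoch big1 // => i _; rewrite mul0r subr0. Qed.

Lemma qpochSl a q k : qpoch a q k.+1 = (1 - a) * qpoch (a * q) q k.
Proof.
rewrite /qpoch big_ord_recl expr0 mulr1; congr (_ * _).
by apply: eq_bigr => i _; rewrite exprS mulrA.
Qed.

Lemma qpoch_eqmod n a b q k : fps_eqmod n a b ->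
  fps_eqmod n (qpoch a q k) (qpoch b q k).
Proof.
move=> ab; apply: fps_eqmod_prod => i; apply: fps_eqmodD => //.
by apply: fps_eqmodN; apply: fps_eqmodM.
Qed.

Lemma qpoch_inf_eqmod n k a q : q 0%N = 0 -> (n <= k)%N ->
  fps_eqmod n (qpoch_inf a q) (qpoch a q k).
Proof. by move=> q0 nk i lti; apply: qpoch_inf_coef (leq_trans lti nk). Qed.

Lemma qpoch_infSl a q : q 0%N = 0 ->
  qpoch_inf a q = (1 - a) * qpoch_inf (a * q) q.
Proof.
move=> q0; apply: fps_eqmodP => n.
apply: fps_eqmod_trans (qpoch_inf_eqmod a q0 (leqnSn n)) _.
rewrite qpochSl; apply: fps_eqmodM => //; apply: fps_eqmod_sym.
exact: qpoch_inf_eqmod.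
Qed.

Lemma qpoch_double a q k :
  qpoch a q k.*2 = qpoch a (q ^+ 2) k * qpoch (a * q) (q ^+ 2) k.
Proof.
elim: k => [|k IHk]; first by rewrite !qpoch0 mulr1.
rewrite doubleS !qpochS IHk -exprM mul2n (exprS q k.*2); ring.
Qed.

Lemma qpoch_inf_split a q : q 0%N = 0 ->
  qpoch_inf a q = qpoch_inf a (q ^+ 2) * qpoch_inf (a * q) (q ^+ 2).
Proof.
move=> q0; apply: fps_eqmodP => n; have q20 := fps_coef0X 1 q0.
apply: (@fps_eqmod_trans _ _ (qpoch a q n.*2)).
  by apply: qpoch_inf_eqmod => //; rewrite -addnn leq_addr.
rewrite qpoch_double; apply: fps_eqmod_sym.
by apply: fps_eqmodM; apply: qpoch_inf_eqmod.
Qed.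

Lemma qpoch_infN a q : q 0%N = 0 ->
  qpoch_inf (- a) q * qpoch_inf a q = qpoch_inf (a ^+ 2) (q ^+ 2).
Proof.
move=> q0; apply: fps_eqmodP => n.
apply: (@fps_eqmod_trans _ _ (qpoch (- a) q n * qpoch a q n)).
  by apply: fps_eqmodM; apply: qpoch_inf_eqmod.
suff -> : qpoch (- a) q n * qpoch a q n = qpoch (a ^+ 2) (q ^+ 2) n.
  by apply: fps_eqmod_sym; apply: qpoch_inf_eqmod => //; apply: fps_coef0X.
rewrite /qpoch -big_split /=; apply: eq_bigr => i _.
by rewrite -exprM mulnC exprM; ring.
Qed.

Lemma qpoch_inf_unit a q : q 0%N = 0 -> a 0%N = 0 ->
  qpoch_inf a q \is a GRing.unit.
Proof.
move=> q0 a0; rewrite fps_unitE (@qpoch_inf_coef _ a q 0 1) //.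
by rewrite qpoch_coef0 // unitr1.
Qed.

(** Euler's theorem on distinct and odd parts. Multiplying by (q^2;q^2)_oo completes (q;q^2)_oo to
    (q;q)_oo, and (-q;q)_oo (q;q)_oo = (q^2;q^2)_oo. *)
Lemma qpoch_inf_distinct_odd q : q 0%N = 0 ->
  qpoch_inf (- q) q * qpoch_inf q (q ^+ 2) = 1.
Proof.
move=> q0; have q20 := fps_coef0X 1 q0.
apply: (mulIr (qpoch_inf_unit q20 q20)).
by rewrite mul1r -mulrA -[RHS]qpoch_infN // (qpoch_inf_split q q0) -expr2.
Qed.

End Congruence.

(** * Euler's and Lebesgue's series through their partial sums *)

Section PartialSums.
Variables (R : comUnitRingType) (q : fps R).
Hypothesis q0 : q 0%N = 0.
Implicit Types (c x : fps R) (n k j : nat).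

Lemma one_subX_unit k : 1 - q ^+ k.+1 \is a GRing.unit.
Proof. by rewrite fps_unitE !fpsE fps_coef0X //= subr0 unitr1. Qed.

(** Lets consecutive terms of a series share one inverse, so that [ring] can compare them. *)
Lemma qpoch_invS k :
  (qpoch q q k)^-1 = (1 - q ^+ k.+1) * (qpoch q q k.+1)^-1.
Proof.
rewrite qpochS -exprS invrM ?one_subX_unit ?qpoch_unit //.
by rewrite mulrA divrr ?one_subX_unit // mul1r.
Qed.

Lemma bin2S j : 'C(j.+2, 2) = ('C(j.+1, 2) + j.+1)%N.
Proof. by rewrite binS bin1. Qed.

Lemma leq_bin2S n : (n <= 'C(n.+1, 2))%N.
Proof. by case: n => // n; rewrite bin2S leq_addl. Qed.

(* Partial sums of Euler's series for (-xq;q)_oo. *)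
Definition euler_sum n x :=
  \sum_(j < n) x ^+ j * q ^+ 'C(j.+1, 2) / qpoch q q j.

(* The difference of the j-th terms of the two sums telescopes; the same holds
   in lebesgue_sum_shift. *)
Lemma euler_sum_shift n x :
  euler_sum n.+1 x = (1 + x * q) * euler_sum n.+1 (x * q)
    - x ^+ n.+1 * q ^+ 'C(n.+2, 2) / qpoch q q n.
Proof.
rewrite /euler_sum; elim: n => [|n IHn].
  rewrite !big_ord1 /= qpoch0 !divr1 bin_small // binn; ring.
rewrite big_ord_recr /= IHn [in RHS]big_ord_recr /= qpoch_invS.
rewrite (bin2S n.+1) (bin2S n) !exprMn !exprD !exprS.
ring.
Qed.

(** Below degree n the last term of [euler_sum_shift] vanishes; n iterations replace x by x q^n,
    which leaves only the term j = 0. *)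
Lemma euler_sum_eqmod n x : fps_eqmod n (euler_sum n x) (qpoch (- x * q) q n).
Proof.
case: n => // n.
have step y : fps_eqmod n.+1 (euler_sum n.+1 y)
    ((1 + y * q) * euler_sum n.+1 (y * q)).
  rewrite euler_sum_shift -[X in fps_eqmod _ _ X]addr0.
  apply: fps_eqmodD => //; rewrite mulrAC -mulNr.
  by apply: fps_eqmodM0; apply: fps_eqmodX0; rewrite // leq_bin2S.
have iter i : fps_eqmod n.+1 (euler_sum n.+1 x)
    (qpoch (- x * q) q i * euler_sum n.+1 (x * q ^+ i)).
  elim: i => [|i IHi]; first by rewrite qpoch0 expr0 mulr1 mul1r.
  apply: fps_eqmod_trans IHi _.
  rewrite qpochS -mulrA; apply: fps_eqmodM => //.
  rewrite exprSr mulrA.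
  have -> : 1 - - x * q * q ^+ i = 1 + x * q ^+ i * q by ring.
  exact: step.
apply: fps_eqmod_trans (iter n.+1) _; rewrite -[X in fps_eqmod _ _ X]mulr1.
apply: fps_eqmodM => //; rewrite /euler_sum big_ord_recl.
rewrite expr0 mul1r qpoch0 divr1 expr0 -[X in fps_eqmod _ _ X]addr0.
apply: fps_eqmodD => //; apply: (fps_eqmod_trans (g := \sum_(i < n) 0)).
  apply: fps_eqmod_sum => i; rewrite lift0 (exprS (x * _)); set y := q ^+ n.+1.
  pose B := x * (x * y) ^+ i * q ^+ 'C(i.+2, 2) / qpoch q q i.+1.
  rewrite [X in fps_eqmod _ X _](_ : _ = B * y); last by rewrite /B; ring.
  by apply: fps_eqmodM0; apply: fps_eqmodX0.
by rewrite big1.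
Qed.

(* Partial sums of Lebesgue's series for (-cq;q^2)_oo (-q;q)_oo. *)
Definition lebesgue_sum n c :=
  \sum_(j < n) q ^+ 'C(j.+1, 2) * qpoch (- c) q j / qpoch q q j.

Lemma lebesgue_sum_shift n c :
  lebesgue_sum n.+1 c = (1 + c * q) * lebesgue_sum n.+1 (c * q ^+ 2)
    - c * q ^+ 'C(n.+2, 2) * qpoch (- c * q) q n / qpoch q q n.
Proof.
rewrite /lebesgue_sum; elim: n => [|n IHn].
  rewrite !big_ord1 /= !qpoch0 !divr1 bin_small // binn; ring.
rewrite big_ord_recr /= IHn [in RHS]big_ord_recr /= qpoch_invS.
(* Both sides are (-cq;q)_(n+2); the new terms thus share the factor (-cq;q)_n with the boundary
   terms. *)
have sh : (1 + c * q) * qpoch (- (c * q ^+ 2)) q n.+1 =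
    qpoch (- c * q) q n * (1 + c * q * q ^+ n) * (1 + c * q * q ^+ n.+1).
  transitivity (qpoch (- c * q) q n.+2); last by rewrite !qpochS; ring.
  by rewrite [RHS]qpochSl (_ : - (c * q ^+ 2) = - c * q * q); ring.
rewrite [in RHS]mulrDr -!mulrA [in RHS](mulrCA (1 + c * q)).
rewrite ![in RHS](mulrA (1 + c * q)) sh (qpochSl (- c)).
rewrite [in RHS](qpochS (- c * q)).
rewrite (bin2S n.+1) (bin2S n) !exprD !exprS.
ring.
Qed.

Lemma lebesgue_sum_eqmod n c : fps_eqmod n (lebesgue_sum n c)
  (qpoch (- c * q) (q ^+ 2) n * qpoch (- q) q n).
Proof.
case: n => // n.
have step y : fps_eqmod n.+1 (lebesgue_sum n.+1 y)
    ((1 + y * q) * lebesgue_sum n.+1 (y * q ^+ 2)).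
  rewrite lebesgue_sum_shift -[X in fps_eqmod _ _ X]addr0.
  apply: fps_eqmodD => //; rewrite -mulrA mulrAC -mulNr.
  by apply: fps_eqmodM0; apply: fps_eqmodX0; rewrite // leq_bin2S.
have iter i : fps_eqmod n.+1 (lebesgue_sum n.+1 c)
    (qpoch (- c * q) (q ^+ 2) i * lebesgue_sum n.+1 (c * (q ^+ 2) ^+ i)).
  elim: i => [|i IHi]; first by rewrite qpoch0 expr0 mulr1 mul1r.
  apply: fps_eqmod_trans IHi _.
  rewrite qpochS -mulrA; apply: fps_eqmodM => //.
  rewrite (exprSr (q ^+ 2) i) mulrA.
  have -> : 1 - - c * q * (q ^+ 2) ^+ i = 1 + c * (q ^+ 2) ^+ i * q by ring.
  exact: step.
apply: fps_eqmod_trans (iter n.+1) _; apply: fps_eqmodM => //.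
(* The parameter is now a multiple of q^(2(n+1)), so each q-Pochhammer numerator is congruent to 1
   and Euler's series at x = 1 remains. *)
apply: (@fps_eqmod_trans _ _ _ (euler_sum n.+1 1)); last first.
  by have := @euler_sum_eqmod n.+1 1; rewrite mulNr mul1r.
apply: fps_eqmod_sum => j; apply: fps_eqmodM => //.
rewrite expr1n mulrC; apply: fps_eqmodM => //.
rewrite -(qpoch0l q j) -oppr0; apply: qpoch_eqmod; apply: fps_eqmodN.
by apply: fps_eqmodM0; rewrite -exprM; apply: fps_eqmodX0; rewrite // leq_pmull.
Qed.

Lemma lebesgue_sum_eqmod_inf n c : fps_eqmod n (lebesgue_sum n c)
  (qpoch_inf (- c * q) (q ^+ 2) * qpoch_inf (- q) q).
Proof.
apply: fps_eqmod_trans (@lebesgue_sum_eqmod n c) _; apply: fps_eqmod_sym.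
by apply: fps_eqmodM; apply: qpoch_inf_eqmod => //; apply: fps_coef0X.
Qed.

(** Termwise, (1 + c)(-cq;q)_j = (-c;q)_j (1 + c q^j), and the 1 cancels. In base q^2 the surviving
    q^(2j) turns q^(j^2+j) into q^(j^2+3j). *)
Lemma lebesgue_sum_contiguous n c :
  (1 + c) * lebesgue_sum n (c * q) - lebesgue_sum n c =
  c * \sum_(j < n) q ^+ ('C(j.+1, 2) + j) * qpoch (- c) q j / qpoch q q j.
Proof.
rewrite /lebesgue_sum !big_distrr -sumrB; apply: eq_bigr => j _ /=.
have sh : (1 + c) * qpoch (- (c * q)) q j = qpoch (- c) q j * (1 + c * q ^+ j).
  have <- : 1 - - c * q ^+ j = 1 + c * q ^+ j by ring.
  by rewrite -qpochS qpochSl mulNr opprK.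
by rewrite -!mulrA (mulrCA (1 + c)) (mulrA (1 + c)) sh exprD; ring.
Qed.

End PartialSums.

(** * The inner sum over m + n = N, by generating functions in z *)

Section Convolution.
Variables (R : comUnitRingType) (q : fps R).
Hypothesis q0 : q 0%N = 0.

Let S := fps R.
Let z : fps S := fpsX S.
(** Euler's expansion of (-qz;q)_oo in powers of z. *)
Let A : fps S := Fps (fun m => q ^+ 'C(m.+1, 2) / qpoch q q m).
(** The expansion of 1/(z^2;q^4)_oo. Multiplying by 1 + z fills in the odd n, which produces the
    floor of n/2. *)
Let C : fps S :=
  Fps (fun n => if odd n then 0 else (qpoch (q ^+ 4) (q ^+ 4) n./2)^-1).

Let scaleA : fps_scale q A = (1 + fpsC (q ^+ 2) * z) * fps_scale (q ^+ 2) A.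
Proof.
apply: fpsP => m; rewrite mulrDl mul1r -mulrA fps_coefD fps_coefCM.
case: m => [|m]; first by rewrite fps_coefXM0 /= !expr0 mulr0 addr0.
rewrite fps_coefXMS /= (qpoch_invS q0 m) (bin2S m) -!exprM mul2n -addnn.
by rewrite !(exprD, exprS); ring.
Qed.

(** With [scaleA] this gives A(z) = (1 + qz)(1 + q^2 z) A(q^2 z), matching the step z -> q^2 z of
    [decompC]. *)
Let decompA : A = (1 + fpsC q * z) * fps_scale q A.
Proof.
apply: fpsP => m; rewrite mulrDl mul1r -mulrA fps_coefD fps_coefCM.
case: m => [|m]; first by rewrite fps_coefXM0 /= !expr0 mulr0 addr0 mul1r.
rewrite fps_coefXMS /= (qpoch_invS q0 m) (bin2S m) !(exprD, exprS); ring.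
Qed.

Let decompC : (1 - z ^+ 2) * C = fps_scale (q ^+ 2) C.
Proof.
have q40 : (q ^+ 4) 0%N = 0 by apply: fps_coef0X.
apply: fpsP => n; rewrite mulrBl mul1r fps_coefD fps_coefN fps_coefXnM.
case: n => [|[|n]] /=; rewrite ?subr0 ?expr0 ?mul1r ?mulr0 //.
rewrite !subSS subn0 negbK; case: ifP => on; first by rewrite mulr0 subr0.
rewrite (qpoch_invS q40 n./2) -!exprM.
have -> : (4 * n./2.+1 = 2 * n.+2)%N by have := odd_double_half n; lia.
ring.
Qed.

Lemma sum_qpoch_half N :
  \sum_(m < N.+1) q ^+ 'C(m.+1, 2)
      / (qpoch q q m * qpoch (q ^+ 4) (q ^+ 4) (N - m)./2)
  = qpoch (- q) (q ^+ 2) N / qpoch (q ^+ 2) (q ^+ 2) N.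
Proof.
pose F : fps S := A * ((1 + z) * C).
have FE k : F k = \sum_(m < k.+1) q ^+ 'C(m.+1, 2)
    / (qpoch q q m * qpoch (q ^+ 4) (q ^+ 4) (k - m)./2).
  rewrite fps_coefM; apply: eq_bigr => m _.
  rewrite invrM ?qpoch_unit ?fps_coef0X // [in RHS](mulrC (_^-1)) mulrA.
  congr (_ * _); move: (k - m)%N => n; rewrite mulrDl mul1r fps_coefD.
  case: n => [|n]; first by rewrite fps_coefXM0 addr0.
  rewrite fps_coefXMS /= uphalf_half.
  by case: (odd n); rewrite ?addr0 ?add0r.
have Fz : (1 - z) * F = (1 + fpsC q * z) * fps_scale (q ^+ 2) F.
  (* Rescaling turns 1 + z into 1 + q^2 z, the factor that [scaleA] supplies; (1 - z)(1 + z) is the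
     factor in [decompC]. *)
  have e1 : 1 + z = 1 + fpsC 1 * z by rewrite mul1r.
  rewrite /F !fps_scaleM {2}e1 fps_scale1X mul1r -decompC {1}decompA scaleA.
  rewrite -/z; ring.
rewrite -FE; elim: N => [|N IHN].
  by rewrite FE big_ord1 !qpoch0 /= mulr1 !divr1 bin_small.
have q20 := fps_coef0X 1 q0.
(* The coefficient of z^(N+1) gives (1 - q^(2N+2)) F_(N+1) = (1 + q^(2N+1)) F_N, the recurrence of
   the right-hand side. *)
have := congr1 (fun f : fps S => f N.+1) Fz.
rewrite mulrBl mulrDl !mul1r -mulrA fps_coefD fps_coefN [RHS]fps_coefD.
have sE k : fps_scale (q ^+ 2) F k = (q ^+ 2) ^+ k * F k by [].
rewrite fps_coefCM !fps_coefXMS !sE => rec.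
apply: (mulrI (one_subX_unit q20 N)).
rewrite mulrCA -(qpoch_invS q20).
rewrite mulrBl mul1r -[X in X - _](subrK (F N)) rec.
rewrite qpochS IHN; ring.
Qed.

End Convolution.

(** * Unconditional summation along antidiagonals *)

Lemma fps_has_sum_diagonal (R : comUnitRingType)
    (F : nat * nat -> fps R) (s : fps R) :
    (forall m n, fps_eqmod (m + n) (F (m, n)) 0) ->
    (forall n, fps_eqmod n
       (\sum_(N < n) \sum_(m < N.+1) F (m : nat, (N - m)%N)) s) ->
  fps_has_sum F s.
Proof.
move=> F0 Fs; have ? := @summability.totally_filter (nat * nat)%type.
apply/fps_cvgP => k.
(* The triangle m + n <= k: pairs outside it do not affect the coefficient at k, so any finite set
   containing it gives the same one. *)
pose D := [seq (m, (N - m)%N) | N <- iota 0 k.+1, m <- iota 0 N.+1].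
have uD : uniq D.
  apply: allpairs_uniq_dep => [|N _|]; rewrite ?iota_uniq //.
  move=> [N m] [N' m'] /allpairsPdep[i [j [_ lej [-> ->]]]].
  move=> /allpairsPdep[i' [j' [_ lej' [-> ->]]]] /= [ej eij].
  move: lej lej'; rewrite !mem_iota => lej lej'.
  have -> : i = i' by lia.
  by rewrite ej.
exists [fset x in D]%fset => // B /= DB.
rewrite -(Fs k.+1 k (ltnSn k)) /summability.partial_sum.
rewrite -(big_seq_fsetE _ B xpredT F) /= !fps_coef_sum.
rewrite -(big_fset_incl _ DB) => [|[m n] _]; last first.
  rewrite in_fset => mnD; apply: (F0 m n).
  rewrite ltnNge; apply: contra mnD => le.
  apply/allpairsPdep; exists (m + n)%N, m.
  by rewrite !mem_iota addKn /= !add0n ltnS le ltnS leq_addr.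
rewrite (perm_big D) /=; last first.
  by apply: uniq_perm => //; [apply: fset_uniq | move=> x; rewrite !inE].
rewrite big_allpairs_dep -[in LHS]/(index_iota 0 k.+1) big_mkord.
apply: eq_bigr => N _; rewrite fps_coef_sum.
by rewrite -[in LHS]/(index_iota 0 N.+1) big_mkord.
Qed.

(** * From Lebesgue's products to the reciprocals modulo 8 *)

Section Products.
Variables (R : comUnitRingType) (q : fps R).
Hypothesis q0 : q 0%N = 0.

(** The two factors in base q^8 merge into (a;q^4)_oo, which pairs with (-a;q^4)_oo to give
    (a^2;q^8)_oo. The hypothesis turns this times b into (q^2;q^4)_oo, and Euler's theorem in base
    q^2 concludes. *)
Lemma lebesgue_product_inv (a b : fps R) :
    qpoch_inf (a ^+ 2) (q ^+ 8) * b = qpoch_inf (q ^+ 2) (q ^+ 4) ->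
  qpoch_inf (- a) (q ^+ 4) * qpoch_inf (- q ^+ 2) (q ^+ 2)
    * (qpoch_inf a (q ^+ 8) * (qpoch_inf (a * q ^+ 4) (q ^+ 8) * b)) = 1.
Proof.
move=> ab; have q40 := fps_coef0X 3 q0.
have AC (x y u v w : fps R) : x * y * (u * (v * w)) = y * (x * (u * v) * w).
  by ring.
rewrite -[RHS](qpoch_inf_distinct_odd (fps_coef0X 1 q0)) -exprM -ab.
have -> : q ^+ 8 = (q ^+ 4) ^+ 2 by rewrite -exprM.
rewrite -(qpoch_infN a q40).
rewrite [X in _ = _ * (_ * X * _)](qpoch_inf_split a q40).
exact: AC.
Qed.

Lemma qpochs_inf3 (a b c p : fps R) :
  qpochs_inf [:: a; b; c] p = qpoch_inf a p * (qpoch_inf b p * qpoch_inf c p).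
Proof. by rewrite /qpochs_inf !big_cons big_nil (mulr1 (qpoch_inf c p)). Qed.

Lemma qpoch_inf_split28 :
  qpoch_inf (q ^+ 2) (q ^+ 8) * qpoch_inf (q ^+ 6) (q ^+ 8)
  = qpoch_inf (q ^+ 2) (q ^+ 4).
Proof.
have -> : q ^+ 8 = (q ^+ 4) ^+ 2 by rewrite -exprM.
have -> : q ^+ 6 = q ^+ 2 * q ^+ 4 by rewrite -exprD.
exact/esym/qpoch_inf_split/fps_coef0X.
Qed.

Lemma lebesgue_product1 :
  qpoch_inf (- q) (q ^+ 4) * qpoch_inf (- q ^+ 2) (q ^+ 2)
  = (qpochs_inf [:: q; q ^+ 5; q ^+ 6] (q ^+ 8))^-1.
Proof.
have U : qpochs_inf [:: q; q ^+ 5; q ^+ 6] (q ^+ 8) \is a GRing.unit.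
  apply: qpochs_inf_unit => [|a]; first exact: fps_coef0X.
  by rewrite !inE => /or3P[] /eqP-> //; apply: fps_coef0X.
(* Here a = q and b = (q^6;q^8)_oo. *)
apply: (mulIr U); rewrite mulVr // qpochs_inf3 (exprS q 4).
by apply: lebesgue_product_inv; apply: qpoch_inf_split28.
Qed.

Lemma lebesgue_product2 :
  qpoch_inf (- q ^+ 3) (q ^+ 4) * qpoch_inf (- q ^+ 2) (q ^+ 2)
  = (qpochs_inf [:: q ^+ 2; q ^+ 3; q ^+ 7] (q ^+ 8))^-1.
Proof.
have U : qpochs_inf [:: q ^+ 2; q ^+ 3; q ^+ 7] (q ^+ 8) \is a GRing.unit.
  apply: qpochs_inf_unit => [|a]; first exact: fps_coef0X.
  by rewrite !inE => /or3P[] /eqP->; apply: fps_coef0X.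
have AC (x y w : fps R) : x * (y * w) = y * (w * x) by ring.
(* Here a = q^3 and b = (q^2;q^8)_oo, so a^2 = q^6. *)
apply: (mulIr U); rewrite mulVr // qpochs_inf3 [X in _ * X = _]AC (exprD q 3 4).
apply: lebesgue_product_inv; rewrite -exprM mulrC.
exact: qpoch_inf_split28.
Qed.

End Products.

(** * Assembling the double sum *)

Lemma double_sum_identity (R : comUnitRingType) (q : fps R) : q 0%N = 0 ->
  fps_has_sum
    (fun mn : nat * nat => let: (m, n) := mn in
       q ^+ (3 * ((m ^ 2 + m) %/ 2) + 2 * n * m + n ^ 2 + 3 * n + 2 * m + 1)%N
       / (qpoch q q m * qpoch (q ^+ 4) (q ^+ 4) (n %/ 2)%N))
    ((qpochs_inf [:: q; q ^+ 5; q ^+ 6] (q ^+ 8))^-1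
     - (qpochs_inf [:: q ^+ 2; q ^+ 3; q ^+ 7] (q ^+ 8))^-1).
Proof.
move=> q0; have q20 := fps_coef0X 1 q0; have q40 := fps_coef0X 3 q0.
apply: fps_has_sum_diagonal => [m n|n].
  rewrite mulrC; apply: fps_eqmodM0; apply: fps_eqmodX0 => //; nia.
have q22 : (q ^+ 2) ^+ 2 = q ^+ 4 by rewrite -exprM.
have binE m : ((m ^ 2 + m) %/ 2 = 'C(m.+1, 2))%N.
  by rewrite bin2 divn2 /= mulSn addnC mulnn.
have binD m : (2 * 'C(m.+1, 2) = m ^ 2 + m)%N.
  by rewrite -binE mulnC divnK // dvdn2 oddD oddX /= addbb.
(* [lebesgue_sum_contiguous] in base q^2 with c = q: the prefactor c supplies the 1 in the exponent
   N^2 + 3N + 1. *)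
have -> : \sum_(N < n) \sum_(m < N.+1)
    q ^+ (3 * ((m ^ 2 + m) %/ 2) + 2 * (N - m) * m + (N - m) ^ 2
          + 3 * (N - m) + 2 * m + 1)%N
      / (qpoch q q m * qpoch (q ^+ 4) (q ^+ 4) ((N - m) %/ 2)%N)
    = (1 + q) * lebesgue_sum (q ^+ 2) n (q * q ^+ 2)
      - lebesgue_sum (q ^+ 2) n q.
  rewrite lebesgue_sum_contiguous big_distrr; apply: eq_bigr => N _ /=.
  rewrite -mulrA -sum_qpoch_half // mulrA big_distrr; apply: eq_bigr => m _ /=.
  rewrite binE divn2 mulrA -exprM -exprS -exprD; congr (q ^+ _ / _).
  have le : (m <= N)%N by rewrite -ltnS.
  move: (binD N) (binD m) le; move: (nat_of_ord m) => {m} j EN Ej /subnKC eN.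
  by move: EN; rewrite -eN addKn; move: (N - j)%N => d; nia.
rewrite -lebesgue_product1 // -lebesgue_product2 //.
apply: fps_eqmodD; last apply: fps_eqmodN.
  (* The prefactor 1 + q is the first factor of (-q;q^4)_oo; the rest, (-q^5;q^4)_oo, comes from c =
     q^3. *)
  rewrite [X in fps_eqmod _ _ X](_ : _ = (1 + q)
    * (qpoch_inf (- q * q ^+ 4) (q ^+ 4) * qpoch_inf (- q ^+ 2) (q ^+ 2))).
    apply: fps_eqmodM; first exact: fps_eqmod_refl.
    have <- : - (q * q ^+ 2) * q ^+ 2 = - q * q ^+ 4 by ring.
    rewrite -{1}q22; exact: lebesgue_sum_eqmod_inf.
  by rewrite (qpoch_infSl (- q) q40) opprK mulrA.
have <- : - q * q ^+ 2 = - q ^+ 3 by ring.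
rewrite -q22; exact: lebesgue_sum_eqmod_inf.
Qed.

Theorem theorem1p2 :
  let q : fps int := fpsX int in
  fps_has_sum
    (fun mn : nat * nat => let: (m, n) := mn in
       q ^+ (3 * ((m ^ 2 + m) %/ 2) + 2 * n * m + n ^ 2 + 3 * n + 2 * m + 1)%N
       / (qpoch q q m * qpoch (q ^+ 4) (q ^+ 4) (n %/ 2)%N))
    ((qpochs_inf [:: q; q ^+ 5; q ^+ 6] (q ^+ 8))^-1
     - (qpochs_inf [:: q ^+ 2; q ^+ 3; q ^+ 7] (q ^+ 8))^-1).
Proof. by move=> q; apply: double_sum_identity. Qed.
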